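(* Let $Z = m_1P_1+\cdots+m_iP_i+\cdots+m_sP_s \subseteq \mathbb{P}^n$ be a set of fat points, fix $i\in\{1,\dots,s\}$, and let $Z' = m_1P_1+\cdots+(m_i-1)P_i+\cdots+m_sP_s$. Let $\nu=\deg Z-\deg Z'$. Then there exist $\nu$ homogeneous polynomials $\{F_1,\dots,F_\nu\}\subseteq R$ such that (a) each $F_j$ ($1\le j\le\nu$) is a separator of $P_i$ of multiplicity $m_i$, and (b) in the ring $R/I_Z$, one has $I_{Z'}/I_Z=(\overline{F}_1,\dots,\overline{F}_\nu)$, where $\overline{F}_j$ denotes the class of $F_j$. Furthermore, these polynomials form a minimal set of generators, in the sense that no set of cardinality less than $\nu$ generates $I_{Z'}/I_Z$.
   Context: $k$ is an algebraically closed field of characteristic zero, $n\ge 1$, and $R=k[x_0,\dots,x_n]$ with the standard grading, the homogeneous coordinate ring of $\mathbb{P}^n=\mathbb{P}^n_k$. For distinct points $P_1,\dots,P_s\in\mathbb{P}^n$ ($s \geq 1$) and positive integers $m_1,\dots,m_s$, the set of fat points $Z=m_1P_1+\cdots+m_sP_s$ is the scheme defined by $I_Z=I_{P_1}^{m_1}\cap\cdots\cap I_{P_s}^{m_s}$, where $I_{P_j}\subseteq R$ is the homogeneous prime ideal of $P_j$. Its degree is $\deg Z=\sum_{j=1}^s\binom{m_j+n-1}{n}$. The same notation is used for $Z'$; if $m_i-1=0$, the point $P_i$ is omitted from $Z'$ (and if no point remains, $I_{Z'}=R$ and $\deg Z'=0$). A separator of $P_i$ of multiplicity $m_i$ is a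 form $F$ with $F\in I_{P_i}^{m_i-1}\setminus I_{P_i}^{m_i}$ and $F\in I_{P_j}^{m_j}$ for all $j\ne i$. *)

(* Defs.v *)
From HB Require Import structures.
From mathcomp Require Import all_boot all_order all_algebra.
From mathcomp Require Import boolp classical_sets.
From mathcomp Require Import mpoly.
Set Implicit Arguments.
Unset Strict Implicit.
Unset Printing Implicit Defensive.
Import GRing.Theory.
Local Open Scope ring_scope.
Local Open Scope classical_set_scope.

(* Ideals are possibly improper; MathComp's [idealr] requires 1 \notin I. *)
Definition is_ideal (A : comNzRingType) (I : set A) : Prop :=
  I 0 /\ forall a u v, I u -> I v -> I (a * u + v).

Definition ideal_span (A : comNzRingType) (S : set A) : set A :=
  smallest (@is_ideal A) S.

(* [ideal_pow I 0] is the whole ring: the empty product is 1. *)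
Definition ideal_pow (A : comNzRingType) (I : set A) (m : nat) : set A :=
  ideal_span [set \prod_(j < m) g j | g in [set g | forall j : 'I_m, I (g j)]].

(* Points of P^n are the lines through the origin of k^(n+1), so that equality
   of points is Leibniz equality. *)
Definition proj_point (k : fieldType) (n : nat) :=
  {L : {vspace 'rV[k]_n.+1} | \dim L == 1%N}.

Definition is_form (k : fieldType) (n : nat) (F : {mpoly k[n]}) : Prop :=
  exists d : nat, F \is d.-homog.

Definition vanishes_at (k : fieldType) (n : nat) (F : {mpoly k[n.+1]})
    (P : proj_point k n) : Prop :=
  forall v, v \in val P -> F.@[v 0] = 0.

Definition point_ideal (k : fieldType) (n : nat) (P : proj_point k n) :
    set {mpoly k[n.+1]} :=
  ideal_span [set F | is_form F /\ vanishes_at F P].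

Section FatPoints.
Variables (k : fieldType) (n s : nat).
Implicit Types (P : 'I_s -> proj_point k n) (m : 'I_s -> nat) (i : 'I_s).

(* A multiplicity 0 stands for an omitted point; it contributes nothing to the
   ideal, nor, for n >= 1, to the degree. *)
Definition fat_ideal P m : set {mpoly k[n.+1]} :=
  \bigcap_(j : 'I_s) ideal_pow (point_ideal (P j)) (m j).

Definition fat_degree m : nat := \sum_(j < s) 'C(m j + n - 1, n).

Definition lower_mult m i : 'I_s -> nat :=
  fun j => if j == i then (m j).-1 else m j.

Definition is_separator P m i (F : {mpoly k[n.+1]}) : Prop :=
  [/\ is_form F,
      ideal_pow (point_ideal (P i)) (m i).-1 F,
      ~ ideal_pow (point_ideal (P i)) (m i) F
    & forall j, j != i -> ideal_pow (point_ideal (P j)) (m j) F].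

End FatPoints.
Arguments fat_degree n {s} m.

Lemma ideal_span_min (A : comNzRingType) (S I : set A) :
  is_ideal I -> S `<=` I -> ideal_span S `<=` I.
Proof. by move=> II SI x; apply. Qed.

Lemma ideal_span_ideal (A : comNzRingType) (S : set A) :
  is_ideal (ideal_span S).
Proof.
split=> [I [[I0 _] _] //|a u v Su Sv I /[dup] II [[_ IM] _]].
by apply: IM; [apply: Su|apply: Sv].
Qed.

Section HomogeneousCoordinateRing.
Variables (k : fieldType) (n s : nat) (P : 'I_s -> proj_point k n).
Variable m : 'I_s -> nat.
Hypotheses (s_gt0 : (0 < s)%N) (m_gt0 : forall j, (0 < m j)%N).

Lemma ideal_pow_point_proper (p : proj_point k n) (e : nat) :
  (0 < e)%N -> ~ ideal_pow (point_ideal p) e 1.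
Proof.
move=> e_gt0 pe1; pose v := vpick (val p).
pose K : set {mpoly k[n.+1]} := [set F | F.@[v 0] = 0].
have idK : is_ideal K.
  split=> [|a u w]; rewrite /K /= ?meval0 // => u0 w0.
  by rewrite mevalD mevalM u0 w0 mulr0 addr0.
have pK : point_ideal p `<=` K.
  by apply: ideal_span_min => // F [_ /(_ v (memv_pick _))].
suff /(_ _ pe1) : ideal_pow (point_ideal p) e `<=` K.
  by rewrite /K /= meval1 => /eqP; rewrite oner_eq0.
apply: ideal_span_min => // _ [g gp <-]; rewrite /K /=.
by rewrite (bigD1 (Ordinal e_gt0)) //= mevalM (pK _ (gp _)) mul0r.
Qed.

Definition fat_pred : {pred {mpoly k[n.+1]}} := fun F => F \in fat_ideal P m.

Lemma fat_pred_idealr_closed : idealr_closed fat_pred.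
Proof.
split; rewrite /fat_pred; first by apply/mem_set => j _; case: (ideal_span_ideal
  [set \prod_(l < m j) g l | g in [set g | forall l, point_ideal (P j) (g l)]]).
- apply/negP => /set_mem /(_ (Ordinal s_gt0) I).
  exact: ideal_pow_point_proper.
- move=> a u v /set_mem Iu /set_mem Iv; apply/mem_set => j _.
  by apply: (ideal_span_ideal _).2; [apply: Iu | apply: Iv].
Qed.

Definition fat_idealr : idealr {mpoly k[n.+1]} :=
  HB.pack_for (idealr {mpoly k[n.+1]}) fat_pred
    (isIdealr.Build _ fat_pred fat_pred_idealr_closed).

Definition fat_ring : comNzRingType := {ideal_quot fat_idealr}.

Definition fat_class (F : {mpoly k[n.+1]}) : fat_ring :=
  (\pi_{ideal_quot fat_idealr} F)%qT.

End HomogeneousCoordinateRing.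
Arguments fat_ring {k n s} P {m} s_gt0 m_gt0.
Arguments fat_class {k n s} P {m} s_gt0 m_gt0 F.

(* Main.v *)
(** Let [d = m_i - 1] and let [v] span the line [P_i]. In coordinates adapted to
    [P_i], setting [x_0 = 1] and keeping the part of degree [d] in the other
    [n] variables gives a linear map [lead] from [I_{P_i}^d] to the space [V]
    of forms of degree [d] in [n] variables, of dimension [nu]. It satisfies
    [lead (a F) = a(v) lead F], it kills [I_{P_i}^(d+1)], and a form in its
    kernel lies in [I_{P_i}^(d+1)]; it maps [I_{Z'}] onto [V], because some
    form [H] in all the [I_{P_j}^{m_j}], [j <> i], has [H(v) <> 0]. The images
    of the degree [e] parts of [I_{Z'}] increase with [e] (multiply by [x_0]),
    so a basis of [V] can be chosen degree by degree: lifts of it generate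
    [I_{Z'}] modulo [I_Z]. Conversely, the images under [lead] of any
    generators of [I_{Z'}] modulo [I_Z] span [V], so there are at least [nu]
    of them. *)
From HB Require Import structures.
Require Import Defs.
From mathcomp Require Import all_boot all_order all_algebra.
From mathcomp Require Import boolp classical_sets.
From mathcomp Require Import mpoly.
Import GRing.Theory.
Local Open Scope ring_scope.
Local Open Scope classical_set_scope.

Set Implicit Arguments.
Unset Strict Implicit.
Unset Printing Implicit Defensive.

(** * Ideals and their powers *)

Section Ideals.
Variables (A : comNzRingType).
Implicit Types (I S : set A) (a b : nat).

Lemma is_idealMl I (c u : A) : is_ideal I -> I u -> I (c * u).
Proof. by move=> [I0 IM] Iu; rewrite -[c * u]addr0; apply: IM. Qed.

Lemma is_idealD I (u v : A) : is_ideal I -> I u -> I v -> I (u + v).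
Proof. by move=> [_ IM] Iu Iv; rewrite -[u]mul1r; apply: IM. Qed.

Lemma is_idealB I (u v : A) : is_ideal I -> I u -> I v -> I (u - v).
Proof. by move=> [_ IM] Iu Iv; rewrite addrC -mulN1r; apply: IM. Qed.

Lemma is_ideal_sum I (T : Type) (r : seq T) (p : pred T) (f : T -> A) :
  is_ideal I -> (forall t, p t -> I (f t)) -> I (\sum_(t <- r | p t) f t).
Proof.
move=> idI If; elim/big_ind: _ => //; first by case: idI.
by move=> u v; apply: is_idealD.
Qed.

Lemma sub_ideal_span S : S `<=` ideal_span S.
Proof. by move=> x Sx I [_ SI]; apply: SI. Qed.

Lemma ideal_span_le S1 S2 : S1 `<=` S2 -> ideal_span S1 `<=` ideal_span S2.
Proof.
move=> S12; apply: (ideal_span_min (ideal_span_ideal S2)) => x /S12.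
exact: sub_ideal_span.
Qed.

Lemma ideal_pow_ideal I a : is_ideal (ideal_pow I a).
Proof. exact: ideal_span_ideal. Qed.

Lemma ideal_pow0 I (u : A) : ideal_pow I 0 u.
Proof.
rewrite -[u]mulr1; apply: (is_idealMl _ (ideal_pow_ideal I 0)).
apply: sub_ideal_span; exists (fun=> 0); first by case.
by rewrite big_ord0.
Qed.

Lemma ideal_pow1 I (u : A) : I u -> ideal_pow I 1 u.
Proof.
move=> Iu; apply: sub_ideal_span; exists (fun=> u) => //.
by rewrite big_ord1.
Qed.

(** The elements multiplying [I^b] into [I^(a+b)] form an ideal, and for fixed [c] so do the [x]
    with [c * x] in [I^(a+b)]. Two uses of minimality reduce the claim to generators, whose factors
    are concatenated through [split]. *)
Lemma ideal_powM I a b (u v : A) :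
  ideal_pow I a u -> ideal_pow I b v -> ideal_pow I (a + b) (u * v).
Proof.
move=> Iu Iv; have idab := ideal_pow_ideal I (a + b).
pose K := [set x | forall y, ideal_pow I b y -> ideal_pow I (a + b) (x * y)].
suff /(_ _ Iu) : ideal_pow I a `<=` K by apply.
have mul_ideal c : is_ideal [set x | ideal_pow I (a + b) (c * x)].
  split=> [|d x y]; first by rewrite /= mulr0; case: idab.
  rewrite /= mulrDr mulrCA => Ix Iy.
  exact: (is_idealD idab (is_idealMl _ idab Ix) Iy).
apply: ideal_span_min => [|_ [g Ig <-] y].
  split=> [y _|d x x' Kx Kx' y Iy]; first by rewrite mul0r; case: idab.
  rewrite mulrDl -mulrA.
  exact: (is_idealD idab (is_idealMl _ idab (Kx _ Iy)) (Kx' _ Iy)).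
move: y; apply: (ideal_span_min (mul_ideal _)) => _ [h Ih <-].
apply: sub_ideal_span.
exists (fun j => match split j with inl j1 => g j1 | inr j2 => h j2 end).
  by move=> j /=; case: (split j).
rewrite big_split_ord /=; congr (_ * _); apply: eq_bigr => j _.
  by rewrite (unsplitK (inl j)).
by rewrite (unsplitK (inr j)).
Qed.

Lemma ideal_powX I a (u : A) : I u -> ideal_pow I a (u ^+ a).
Proof.
move=> Iu; elim: a => [|a IHa]; first exact: ideal_pow0.
by rewrite exprS -add1n; apply: ideal_powM => //; apply: ideal_pow1.
Qed.

Lemma ideal_pow_le I a b : (a <= b)%N -> ideal_pow I b `<=` ideal_pow I a.
Proof.
move=> ab; apply: (ideal_span_min (ideal_pow_ideal I a)) => _ [g Ig <-].
(* The factors beyond the first [a] are absorbed as a coefficient. *)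
have -> : \prod_j g j =
    \prod_(j < a) g (widen_ord ab j) * \prod_(j < b | (a <= j)%N) g j.
  rewrite (bigID (fun j : 'I_b => (j < a)%N)) /=; congr (_ * _).
    by rewrite (big_ord_narrow ab).
  by apply: eq_big => j //; rewrite -leqNgt.
rewrite mulrC; apply: (is_idealMl _ (ideal_pow_ideal I a)).
by apply: sub_ideal_span; exists (fun j => g (widen_ord ab j)).
Qed.

Lemma ideal_pow_prod I n (e : 'I_n -> nat) (u : 'I_n -> A) :
  (forall j, ideal_pow I (e j) (u j)) ->
  ideal_pow I (\sum_j e j) (\prod_j u j).
Proof.
move=> Iu; apply: (big_ind2 (fun a x => ideal_pow I a x)) => //.
  exact: ideal_pow0.
by move=> a x b y; apply: ideal_powM.
Qed.

End Ideals.

(** * Order of vanishing with respect to a weight *)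

Section Order.
Variables (k : fieldType) (N : nat).
Implicit Types (mf : measure N) (p q : {mpoly k[N]}).

(** With [mdeg] this is vanishing to order [e] at the origin; with [tail_deg] below, vanishing to
    order [e] at the coordinate point [[1:0:...:0]]. *)
Definition order_ge mf e p := forall X, (mf X < e)%N -> p@_X = 0.

Lemma order_ge0 mf e : order_ge mf e 0.
Proof. by move=> X _; rewrite mcoeff0. Qed.

Lemma order_geD mf e p q :
  order_ge mf e p -> order_ge mf e q -> order_ge mf e (p + q).
Proof. by move=> op oq X Xe; rewrite mcoeffD op ?oq ?addr0. Qed.

Lemma order_ge_sum mf e (T : Type) (r : seq T) (P : pred T)
    (f : T -> {mpoly k[N]}) :
  (forall t, P t -> order_ge mf e (f t)) ->
  order_ge mf e (\sum_(t <- r | P t) f t).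
Proof.
move=> of_; elim/big_ind: _ => //; first exact: order_ge0.
by move=> p q; apply: order_geD.
Qed.

Lemma order_geM mf d e p q :
  order_ge mf d p -> order_ge mf e q -> order_ge mf (d + e) (p * q).
Proof.
move=> op oq X Xde; rewrite mcoeffM big1 // => -[Y Z] /= /eqP XE.
have YZ : (mf Y + mf Z < d + e)%N by rewrite -mfD -XE.
case: (ltnP (mf Y) d) => [/op ->|dY]; first by rewrite mul0r.
case: (ltnP (mf Z) e) => [/oq ->|eZ]; first by rewrite mulr0.
by move: YZ; rewrite ltnNge leq_add.
Qed.

Lemma order_geMl mf e p q : order_ge mf e q -> order_ge mf e (p * q).
Proof. by move=> oq; rewrite -[e]add0n; apply: order_geM. Qed.

Lemma order_ge_ideal mf e : is_ideal (order_ge mf e).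
Proof.
split=> [|p q r oq or]; first exact: order_ge0.
by apply: order_geD => //; apply: order_geMl.
Qed.

Lemma order_ge_prod mf n (e : 'I_n -> nat) (u : 'I_n -> {mpoly k[N]}) :
  (forall j, order_ge mf (e j) (u j)) ->
  order_ge mf (\sum_j e j) (\prod_j u j).
Proof.
move=> ou; apply: (big_ind2 (fun a x => order_ge mf a x)) => //.
by move=> a x b y; apply: order_geM.
Qed.

Lemma mcoeff_pihomog mf d p X :
  (pihomog mf d p)@_X = if mf X == d then p@_X else 0.
Proof.
rewrite [p in RHS]mpolyE pihomogE !raddf_sum /=.
case: ifP => Xd.
  rewrite big_mkcond; apply: eq_bigr => Y _.
  rewrite mcoeffZ mcoeffX; case: (eqVneq Y X) => [->|_]; first by rewrite Xd.
  by rewrite mulr0 if_same.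
rewrite big1 // => Y Yd; rewrite mcoeffZ mcoeffX.
case: (eqVneq Y X) => [YX|_]; last by rewrite mulr0.
by rewrite -YX Yd in Xd.
Qed.

Lemma order_ge_pihomog mf mf' e d p :
  order_ge mf e p -> order_ge mf e (pihomog mf' d p).
Proof. by move=> op X Xe; rewrite mcoeff_pihomog op // if_same. Qed.

Lemma pihomog_order_ge mf d p : order_ge mf d.+1 p -> pihomog mf d p = 0.
Proof.
move=> op; apply/mpolyP=> X; rewrite mcoeff_pihomog mcoeff0.
by case: eqP => // Xd; apply: op; rewrite Xd.
Qed.

Lemma order_ge_pihomogS mf d p :
  order_ge mf d p -> pihomog mf d p = 0 -> order_ge mf d.+1 p.
Proof.
move=> op /mpolyP p0 X; rewrite ltnS leq_eqVlt => /orP[/eqP Xd|/op //].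
by move: (p0 X); rewrite mcoeff_pihomog Xd eqxx mcoeff0.
Qed.

(** Once its constant term is removed, [p] has order at least 1, so its product with [q] starts in
    degree [d+1]; only the constant term counts. *)
Lemma pihomogM_order_ge d p q : order_ge mdeg d q ->
  pihomog mdeg d (p * q) = p@_0%MM *: pihomog mdeg d q.
Proof.
move=> oq; rewrite -[p in LHS](subrK (p@_0)%:MP) mulrDl linearD /=.
rewrite mul_mpolyC linearZ /= [X in X + _]pihomog_order_ge ?add0r //.
rewrite -add1n; apply: order_geM => // X; rewrite ltnS leqn0 mdeg_eq0.
by move=> /eqP ->; rewrite mcoeffB mcoeffC eqxx mulr1 subrr.
Qed.

End Order.

(** * Linear changes of coordinates and dehomogenization *)

Section Substitution.
Variable k : fieldType.

Lemma comp_mpolyA (a b c : nat) (F : {mpoly k[a]}) (lp : a.-tuple {mpoly k[b]})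
    (lq : b.-tuple {mpoly k[c]}) :
  (F \mPo lp) \mPo lq = F \mPo [tuple tnth lp j \mPo lq | j < a].
Proof.
rewrite [F \mPo lp]comp_mpolyE raddf_sum [RHS]comp_mpolyE /=.
apply: eq_bigr => X _; rewrite linearZ rmorph_prod /=; congr (_ *: _).
by apply: eq_bigr => j _; rewrite rmorphXn tnth_mktuple.
Qed.

Lemma dhomog_prodX (b a : nat) (f : 'I_a -> {mpoly k[b]}) (X : 'X_{1..a}) :
  (forall j, f j \is 1.-homog) -> \prod_j f j ^+ X j \is (mdeg X).-homog.
Proof.
move=> f1; rewrite mdegE.
apply: (big_ind2 (fun (p : {mpoly k[b]}) e => p \is e.-homog)).
- exact: dhomog1.
- by move=> p d q e; apply: dhomogM.
- by move=> j _; have := dhomogMn (X j) (f1 j); rewrite mul1n.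
Qed.

Lemma comp_mpoly_pihomog (a b d : nat) (lq : a.-tuple {mpoly k[b]})
    (F : {mpoly k[a]}) :
  (forall j, tnth lq j \is 1.-homog) ->
  pihomog mdeg d (F \mPo lq) = pihomog mdeg d F \mPo lq.
Proof.
move=> lq1; rewrite [F in LHS]mpolyE [pihomog mdeg d F]pihomogE.
rewrite !(raddf_sum (comp_mpoly lq)) (raddf_sum (pihomog mdeg d)) /=.
rewrite [RHS]big_mkcond /=.
apply: eq_bigr => X _; rewrite !linearZ /= comp_mpolyX.
have hX := dhomog_prodX X lq1; case: (eqVneq (mdeg X) d) => [<-|Xd].
  by rewrite pihomog_dE.
by rewrite (@pihomog_ne0 _ _ _ (mdeg X)) // scaler0.
Qed.

Variable N : nat.
Implicit Types (A B : 'M[k]_N) (F : {mpoly k[N]}).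

(** The coefficients are the columns of [A], so that substitution is composition with [w |-> w A] on
    row vectors. *)
Definition lin_forms A : N.-tuple {mpoly k[N]} :=
  [tuple \sum_l A l j *: 'X_l | j < N].

Definition lin_subst A F : {mpoly k[N]} := F \mPo lin_forms A.

HB.instance Definition _ A := GRing.RMorphism.copy (lin_subst A)
  (comp_mpoly (lin_forms A)).

Lemma lin_substZ A c F : lin_subst A (c *: F) = c *: lin_subst A F.
Proof. exact: comp_mpolyZ. Qed.

Lemma lin_form_dhomog A j : tnth (lin_forms A) j \is 1.-homog.
Proof.
rewrite tnth_mktuple; apply: rpred_sum => l _; apply: rpredZ.
by rewrite dhomogX /= mdeg1.
Qed.

Lemma lin_substM A B F : lin_subst B (lin_subst A F) = lin_subst (B *m A) F.
Proof.
rewrite /lin_subst comp_mpolyA; congr comp_mpoly; apply: eq_from_tnth => j.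
rewrite !tnth_mktuple raddf_sum /=.
under eq_bigr do rewrite linearZ /= comp_mpolyXU -tnth_nth tnth_mktuple.
under [RHS]eq_bigr do rewrite mxE scaler_suml.
rewrite exchange_big /=; apply: eq_bigr => l _; rewrite scaler_sumr.
by apply: eq_bigr => l' _; rewrite scalerA mulrC.
Qed.

Lemma lin_subst1 F : lin_subst 1%:M F = F.
Proof.
rewrite -[RHS]comp_mpoly_id /lin_subst; congr comp_mpoly.
apply: eq_from_tnth => j; rewrite !tnth_mktuple (bigD1 j) //= mxE eqxx scale1r.
by rewrite big1 ?addr0 // => l /negPf lj; rewrite mxE lj scale0r.
Qed.

Lemma lin_substK A : A \in unitmx -> cancel (lin_subst A) (lin_subst (invmx A)).
Proof. by move=> uA F; rewrite lin_substM mulVmx // lin_subst1. Qed.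

Lemma lin_substVK A :
  A \in unitmx -> cancel (lin_subst (invmx A)) (lin_subst A).
Proof. by move=> uA F; rewrite lin_substM mulmxV // lin_subst1. Qed.

Lemma lin_subst_pihomog A d F :
  pihomog mdeg d (lin_subst A F) = lin_subst A (pihomog mdeg d F).
Proof. by rewrite comp_mpoly_pihomog // => j; apply: lin_form_dhomog. Qed.

Lemma lin_subst_dhomog A d F : F \is d.-homog -> lin_subst A F \is d.-homog.
Proof.
by move=> hF; rewrite homog_piE lin_subst_pihomog pihomog_dE.
Qed.

Lemma meval_lin_subst A F (w : 'rV_N) :
  (lin_subst A F).@[w 0] = F.@[(w *m A) 0].
Proof.
rewrite comp_mpoly_meval; apply: meval_eq => j; rewrite tnth_mktuple mxE.
rewrite raddf_sum /=; apply: eq_bigr => l _.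
by rewrite mevalZ mevalXU mulrC.
Qed.

End Substitution.

Section Dehomogenization.
Variables (k : fieldType) (n : nat).
Implicit Types (G : {mpoly k[n.+1]}) (w : {mpoly k[n]}).

Definition mnm_tail (X : 'X_{1..n.+1}) : 'X_{1..n} :=
  [multinom X (lift ord0 j) | j < n].

Definition tail_deg (X : 'X_{1..n.+1}) : nat := mdeg (mnm_tail X).

Lemma mnm_tail0 : mnm_tail 0%MM = 0%MM.
Proof. by apply/mnmP => j; rewrite mnmE !mnm0E. Qed.

Lemma mnm_tailD X Y : mnm_tail (X + Y)%MM = (mnm_tail X + mnm_tail Y)%MM.
Proof. by apply/mnmP => j; rewrite mnmE !mnmDE !mnmE. Qed.

Lemma tail_deg0 : tail_deg 0%MM = 0%N.
Proof. by rewrite /tail_deg mnm_tail0 mdeg0. Qed.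

Lemma tail_degD : {morph tail_deg : X Y / (X + Y)%MM >-> (X + Y)%N}.
Proof. by move=> X Y; rewrite /tail_deg mnm_tailD mdegD. Qed.

HB.instance Definition _ := isMeasure.Build n.+1 tail_deg tail_deg0 tail_degD.

Lemma mdeg_tail X : mdeg X = (X ord0 + mdeg (mnm_tail X))%N.
Proof.
rewrite !mdegE big_ord_recl; congr addn.
by apply: eq_bigr => j _; rewrite mnmE.
Qed.

Lemma mnm_tail_inj X Y : mdeg X = mdeg Y -> mnm_tail X = mnm_tail Y -> X = Y.
Proof.
move=> XY tXY; apply/mnmP => j; case: (unliftP ord0 j) => [j' ->|->].
  by move/mnmP/(_ j'): tXY; rewrite !mnmE.
by apply/eqP; rewrite -(eqn_add2r (mdeg (mnm_tail X))) {2}tXY -!mdeg_tail XY.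
Qed.

Definition dehom_vars : n.+1.-tuple {mpoly k[n]} :=
  [tuple if unlift ord0 j is Some j' then 'X_j' else 1 | j < n.+1].

Definition dehom G : {mpoly k[n]} := G \mPo dehom_vars.

HB.instance Definition _ := GRing.LRMorphism.copy dehom (comp_mpoly dehom_vars).

Lemma dehomX X : dehom 'X_[X] = 'X_[mnm_tail X].
Proof.
rewrite /dehom comp_mpolyX big_ord_recl tnth_mktuple unlift_none expr1n mul1r.
rewrite mpolyXE_id; apply: eq_bigr => j _.
by rewrite tnth_mktuple liftK mnmE.
Qed.

Lemma dehomE G : dehom G = \sum_(X <- msupp G) G@_X *: 'X_[mnm_tail X].
Proof.
rewrite [G in LHS]mpolyE raddf_sum; apply: eq_bigr => X _ /=.
by rewrite linearZ /= dehomX.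
Qed.

Lemma order_ge_dehom e G :
  order_ge tail_deg e G -> order_ge mdeg e (dehom G).
Proof.
move=> oG; rewrite dehomE; apply: order_ge_sum => X _ Y Ye.
rewrite mcoeffZ mcoeffX; case: eqP => [XY|_]; last by rewrite mulr0.
by rewrite oG ?mul0r // /= /tail_deg XY.
Qed.

(** Setting [x_0 = 1] merges no two monomials of a form: the exponent of [x_0] is recovered from the
    total degree. *)
Lemma mcoeff_dehom d G X :
  G \is d.-homog -> mdeg X = d -> (dehom G)@_(mnm_tail X) = G@_X.
Proof.
move=> hG Xd; rewrite dehomE [G in RHS]mpolyE !raddf_sum /=.
rewrite !big_seq; apply: eq_bigr => Y GY; rewrite !mcoeffZ !mcoeffX.
congr (_ * (nat_of_bool _)%:R); apply/eqP/eqP => [|-> //].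
by apply: mnm_tail_inj; rewrite Xd (dhomogP _ _ _ hG).
Qed.

(** Converse of [order_ge_dehom] for forms, where no cancellation occurs on setting [x_0 = 1]. *)
Lemma dhomog_order_ge d e G : G \is d.-homog ->
  order_ge mdeg e (dehom G) -> order_ge tail_deg e G.
Proof.
move=> hG oG X Xe; case: (eqVneq (mdeg X) d) => [Xd|].
  by rewrite -(mcoeff_dehom hG Xd) oG.
exact: dhomog_nemf_coeff.
Qed.

(** Only pure powers of [x_0] contribute to either side. *)
Lemma mcoeff0_dehom G : (dehom G)@_0%MM = G.@[(delta_mx 0 ord0 : 'rV_n.+1) 0].
Proof.
rewrite dehomE mevalE raddf_sum; apply: eq_bigr => X _ /=.
rewrite mcoeffZ mcoeffX; congr (_ * _).
rewrite big_ord_recl mxE !eqxx expr1n mul1r -mdeg_eq0 mdegE sum_nat_eq0.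
case: forallP => [X0|X0].
  by rewrite big1 // => j _; move: (X0 j); rewrite mnmE => /eqP ->.
have /existsP[j] : [exists j, mnm_tail X j != 0%N].
  by rewrite -negb_forall; apply/forallP.
rewrite mnmE => Xj; rewrite (bigD1 j) //= mxE eqxx /=.
by rewrite expr0n (negPf Xj) mul0r.
Qed.

Definition tail_vars : n.-tuple {mpoly k[n.+1]} :=
  [tuple 'X_(lift ord0 j) | j < n].

(** A section of [dehom] that preserves degrees; it lifts a prescribed leading form to a form in all
    variables. *)
Definition tail_incl w : {mpoly k[n.+1]} := w \mPo tail_vars.

Lemma dehom_tail_incl w : dehom (tail_incl w) = w.
Proof.
rewrite /dehom comp_mpolyA -[RHS]comp_mpoly_id; congr comp_mpoly.
apply: eq_from_tnth => j; rewrite !tnth_mktuple comp_mpolyXU -tnth_nth.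
by rewrite tnth_mktuple liftK.
Qed.

Lemma tail_incl_dhomog d w : w \is d.-homog -> tail_incl w \is d.-homog.
Proof.
move=> hw; rewrite homog_piE comp_mpoly_pihomog ?pihomog_dE // => j.
by rewrite tnth_mktuple dhomogX /= mdeg1.
Qed.

Lemma tail_incl_order_ge d w :
  w \is d.-homog -> order_ge tail_deg d (tail_incl w).
Proof.
move=> hw; apply: (dhomog_order_ge (tail_incl_dhomog hw)).
rewrite dehom_tail_incl => X Xd.
by rewrite (dhomog_nemf_coeff hw) // neq_ltn Xd.
Qed.

End Dehomogenization.

(** * Powers of the ideal of a point *)

Section PointIdeal.
Variables (k : fieldType) (n : nat).
Implicit Types (P Q : proj_point k n) (A : 'M[k]_n.+1) (F : {mpoly k[n.+1]}).

(** Provides coordinates adapted to [P]: in the basis of rows of [A] the point becomes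
    [[1:0:...:0]]. *)
Lemma point_frame P :
  exists2 A, A \in unitmx & val P = <[row ord0 A]>%VS.
Proof.
have /eqP dimP := valP P; set v := vpick (val P).
have v0 : v != 0 by rewrite vpick0 -dimv_eq0 dimP.
exists (row_ebase v); first exact: row_ebase_unit.
apply/esym/eqP; rewrite eqEdim dimP dim_vline -/v.
set r := row _ _.
(* The decomposition of [v] by Gaussian elimination has rank one, so only row 0 of [row_ebase v]
   survives. *)
have vr : v = (col_ebase v 0 0) *: r.
  rewrite -[LHS]mulmx_ebase rank_rV v0 -mulmxA.
  rewrite [col_ebase v in LHS]mx11_scalar mul_scalar_mx /r rowE.
  congr (_ *: (_ *m _)); apply/rowP => j; rewrite !mxE eqxx /= andbT.
  by rewrite eq_sym -val_eqE /=; case: (val j).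
have vP : (<[v]> = val P)%VS.
  by apply/eqP; rewrite eqEdim dimP dim_vline v0 -memvE memv_pick.
set c := col_ebase v 0 0 in vr; have c0 : c != 0.
  by apply: contraNneq v0 => c0; rewrite vr c0 scale0r.
rewrite -memvE -vP; have -> : r = c^-1 *: v.
  by rewrite vr scalerA mulVf // scale1r.
by rewrite memvZ ?memv_line // scaler_eq0 invr_eq0 (negPf c0) (negPf v0).
Qed.

Lemma order_ge_lin_subst_ideal A e :
  is_ideal [set F | order_ge (@tail_deg n) e (lin_subst A F)].
Proof.
have [o0 oM] := @order_ge_ideal k n.+1 (@tail_deg n) e.
split=> [|p q r oq or] /=; first by rewrite rmorph0.
by rewrite rmorphD rmorphM; apply: oM.
Qed.

(** The [j]-th coordinate function relative to the basis formed by the rows of [A]. *)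
Definition coord_form A (j : 'I_n.+1) : {mpoly k[n.+1]} :=
  lin_subst (invmx A) 'X_j.

Lemma coord_form_dhomog A j : coord_form A j \is 1.-homog.
Proof. by apply: lin_subst_dhomog; rewrite dhomogX /= mdeg1. Qed.

Lemma lin_subst_coord_form A j :
  A \in unitmx -> lin_subst A (coord_form A j) = 'X_j.
Proof. by move=> uA; rewrite /coord_form lin_substVK. Qed.

Variables (P : proj_point k n) (A : 'M[k]_n.+1).
Hypotheses (unitA : A \in unitmx) (P_A : val P = <[row ord0 A]>%VS).

Lemma meval_point F : F.@[(row ord0 A) 0] = (dehom (lin_subst A F))@_0%MM.
Proof. by rewrite mcoeff0_dehom meval_lin_subst rowE. Qed.

Lemma coord_form_point j : point_ideal P (coord_form A (lift ord0 j)).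
Proof.
apply: sub_ideal_span; split; first by exists 1%N; apply: coord_form_dhomog.
move=> v; rewrite P_A => /vlineP[c ->].
rewrite rowE scalemxAl -meval_lin_subst lin_subst_coord_form // mevalXU.
by rewrite !mxE andbF mulr0.
Qed.

Lemma point_ideal_order F :
  point_ideal P F -> order_ge (@tail_deg n) 1 (lin_subst A F).
Proof.
move: F; apply: (ideal_span_min (order_ge_lin_subst_ideal A 1)).
move=> F [[d hF] F0]; apply: (dhomog_order_ge (lin_subst_dhomog A hF)).
move=> X; rewrite ltnS leqn0 mdeg_eq0 => /eqP ->.
by rewrite -meval_point F0 // P_A memv_line.
Qed.

(** In adapted coordinates [I_P] is generated by all variables but [x_0], so membership in [I_P^e]
    can be read off monomial by monomial. *)
Lemma ideal_pow_pointP e F :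
  ideal_pow (point_ideal P) e F <-> order_ge (@tail_deg n) e (lin_subst A F).
Proof.
split.
  move: F; apply: (ideal_span_min (order_ge_lin_subst_ideal A e)).
  move=> _ [g Pg <-] /=; rewrite rmorph_prod.
  (* Each of the [e] factors has order at least 1, and orders add up. *)
  have e1 : (\sum_(j < e) 1)%N = e by rewrite sum1_card card_ord.
  rewrite -[X in order_ge _ X]e1.
  by apply: order_ge_prod => j; apply: point_ideal_order.
move=> oF; rewrite -[F](lin_substK unitA).
set G := lin_subst A F in oF *.
(* Each monomial of [G] pulls back to a product of coordinate forms; those of positive index lie in
   [I_P], and at least [e] of them occur. *)
rewrite [G]mpolyE (raddf_sum (lin_subst _)) big_seq.
apply: is_ideal_sum (ideal_pow_ideal _ _) _ => X GX.
rewrite /= lin_substZ -mul_mpolyC.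
apply: (is_idealMl _ (ideal_pow_ideal _ _)).
rewrite mpolyXE_id rmorph_prod big_ord_recl.
apply: (is_idealMl _ (ideal_pow_ideal _ _)).
have eX : (e <= tail_deg X)%N.
  rewrite leqNgt; apply: contraL GX => /oF GX0.
  by rewrite mcoeff_msupp GX0 eqxx.
apply: (ideal_pow_le eX); rewrite /tail_deg mdegE.
apply: ideal_pow_prod => j; rewrite mnmE rmorphXn.
by apply: ideal_powX; apply: coord_form_point.
Qed.

End PointIdeal.

Section PointIdealPowers.
Variables (k : fieldType) (n : nat).
Implicit Types (P Q : proj_point k n) (F : {mpoly k[n.+1]}).

(** The order condition concerns single monomials, so it passes to homogeneous components. *)
Lemma ideal_pow_point_pihomog P e d F :
  ideal_pow (point_ideal P) e F ->
  ideal_pow (point_ideal P) e (pihomog mdeg d F).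
Proof.
have [A uA PA] := point_frame P.
rewrite !(ideal_pow_pointP uA PA) -lin_subst_pihomog.
exact: order_ge_pihomog.
Qed.

(** If all coordinate forms of positive index adapted to [P] vanished at [v], then [v] would lie on
    the line [P]. *)
Lemma point_separating_form P Q : P <> Q -> forall v, val Q = <[v]>%VS ->
  exists2 F, F \is 1.-homog & point_ideal P F /\ F.@[v 0] != 0.
Proof.
move=> PQ v Qv; have [A uA PA] := point_frame P.
have [j Fj] : exists j, (coord_form A (lift ord0 j)).@[v 0] != 0.
  apply: contrapT => F0; apply: PQ; apply: val_inj.
  apply/esym/eqP; rewrite eqEdim (eqP (valP P)) (eqP (valP Q)) leqnn andbT.
  rewrite Qv PA -memvE; apply/vlineP; exists ((v *m invmx A) 0 0).
  rewrite -[LHS](mulmxKV uA) rowE scalemxAl; congr (_ *m _).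
  apply/rowP => j; case: (unliftP ord0 j) => [j' ->|->]; last first.
    by rewrite !mxE eqxx mulr1.
  rewrite !mxE andbF mulr0; apply: contrapT => /eqP vj; apply: F0; exists j'.
  by rewrite meval_lin_subst mevalXU mxE.
exists (coord_form A (lift ord0 j)); first exact: coord_form_dhomog.
by split=> //; apply: coord_form_point.
Qed.

(** Take the product over [j != i] of the [m j]-th powers of linear forms that vanish at [P j] but
    not at [v]. *)
Lemma fat_separating_form s (P : 'I_s -> proj_point k n) (m : 'I_s -> nat) i v :
  injective P -> val (P i) = <[v]>%VS ->
  exists F, [/\ is_form F, F.@[v 0] != 0
    & forall j, j != i -> ideal_pow (point_ideal (P j)) (m j) F].
Proof.
move=> P_inj Pv.
have /choice[f f_sep] (j : 'I_s) : exists F : {mpoly k[n.+1]},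
    j != i -> F \is 1.-homog /\ (point_ideal (P j) F /\ F.@[v 0] != 0).
  case: (eqVneq j i) => [_|/eqP ji]; first by exists 0.
  have Pji : P j <> P i by move/P_inj.
  by have [F F1 FP] := point_separating_form Pji Pv; exists F.
exists (\prod_(j | j != i) f j ^+ m j); split.
- exists (\sum_(j | j != i) m j)%N.
  apply: (big_ind2 (fun (p : {mpoly k[n.+1]}) e => p \is e.-homog)).
  + exact: dhomog1.
  + by move=> p d q e; apply: dhomogM.
  + by move=> j /f_sep[/(dhomogMn (m j)) hf _]; rewrite mul1n in hf.
- rewrite rmorph_prod prodf_seq_neq0; apply/allP => j _; apply/implyP.
  by move=> /f_sep[_ [_ fv]]; rewrite rmorphXn expf_neq0.
- move=> j ji; rewrite (bigD1 j) //= mulrC.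
  apply: (is_idealMl _ (ideal_pow_ideal _ _)); apply: ideal_powX.
  by have [_ []] := f_sep j ji.
Qed.

End PointIdealPowers.

(** * Leading forms and separators *)

Section Spans.
Variables (k : fieldType) (V : vectType k).

(** Induction over linear combinations, for a subspace given only as a predicate. *)
Lemma span_closure (Q : V -> Prop) (X : seq V) :
  Q 0 -> (forall c u v, Q u -> Q v -> Q (c *: u + v)) ->
  {in X, forall x, Q x} -> {in <<X>>%VS, forall v, Q v}.
Proof.
move=> Q0 QD; elim: X => [|x X IHX] QX v.
  by rewrite span_nil memv0 => /eqP ->.
rewrite span_cons => /memv_addP[_ /vlineP[c ->] [w wX ->]].
apply: QD; first by apply: QX; rewrite mem_head.
by apply: IHX wX => y yX; apply: QX; rewrite inE yX orbT.
Qed.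

(** Elements of [S] whose image is not yet in the span are added one by one; the dimension of [V]
    bounds their number. *)
Lemma free_extension (T : eqType) (f : T -> V) (S : set T) (s0 : seq T) :
  free (map f s0) ->
  exists2 s, free (map f (s ++ s0)) /\ (forall t, t \in s -> S t)
    & forall t, S t -> f t \in <<map f (s ++ s0)>>%VS.
Proof.
move: {2}(\dim {:V} - size s0)%N (leqnn (\dim {:V} - size s0)%N) => d.
elim: d s0 => [|d IHd] s0 ds free0.
  exists [::] => //= t _; move: (memvf (f t)).
  suff /eqP <- : <<map f s0>>%VS == fullv by [].
  rewrite eqEdim subvf (eqP free0) size_map -subn_eq0.
  by rewrite leqn0 in ds.
have [Sspan|/existsNP[t /not_implyP[St ft]]] :=
    pselect (forall t, S t -> f t \in <<map f s0>>%VS).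
  by exists [::].
have free1 : free (map f (t :: s0)).
  by rewrite /= free_cons free0 andbT; apply/negP.
have [||s [frees sS] sspan] := IHd (t :: s0) => //.
  by rewrite /= subnS -subn1 leq_subLR add1n.
exists (s ++ [:: t]); last by move=> t' St'; rewrite -catA; apply: sspan.
split=> [|t']; first by rewrite -catA.
by rewrite mem_cat inE => /orP[/sS|/eqP ->].
Qed.

End Spans.

Section LeadingForm.
Variables (k : fieldType) (n d : nat) (A : 'M[k]_n.+1).
Implicit Types F : {mpoly k[n.+1]}.

(** Defined on every polynomial so as to be linear everywhere; it is the lowest-order part at the
    point only when the order there is at least [d]. *)
Definition leading_form F : dhomog n k d :=
  DHomog (pihomogP mdeg d (dehom (lin_subst A F))).

Lemma leading_form_is_linear : linear leading_form.
Proof.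
move=> c F G; apply: val_inj => /=.
by rewrite rmorphD /= lin_substZ !linearP.
Qed.

HB.instance Definition _ := GRing.isLinear.Build k {mpoly k[n.+1]}
  (dhomog n k d) _ leading_form leading_form_is_linear.

Lemma leading_formM F G : order_ge (@tail_deg n) d (lin_subst A G) ->
  leading_form (F * G) = F.@[(row ord0 A) 0] *: leading_form G.
Proof.
move=> oG; apply: val_inj => /=; rewrite !rmorphM /=.
rewrite pihomogM_order_ge; last exact: order_ge_dehom.
by rewrite mcoeff0_dehom meval_lin_subst rowE.
Qed.

Lemma leading_form_eq0 F :
  order_ge (@tail_deg n) d.+1 (lin_subst A F) -> leading_form F = 0.
Proof.
by move=> oF; apply: val_inj; apply: pihomog_order_ge; apply: order_ge_dehom.
Qed.

(** The vanishing of the degree [d] part raises the order of the dehomogenization, and homogeneity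
    carries this back to the form. *)
Lemma leading_form_ker F : is_form F ->
  order_ge (@tail_deg n) d (lin_subst A F) -> leading_form F = 0 ->
  order_ge (@tail_deg n) d.+1 (lin_subst A F).
Proof.
move=> [e hF] oF /(congr1 val) /= lF.
apply: (dhomog_order_ge (lin_subst_dhomog A hF)).
by apply: order_ge_pihomogS => //; apply: order_ge_dehom.
Qed.

End LeadingForm.

Section FatIdeal.
Variables (k : fieldType) (n s : nat) (P : 'I_s -> proj_point k n).
Implicit Types (m : 'I_s -> nat) (F : {mpoly k[n.+1]}).

Lemma fat_ideal_ideal m : is_ideal (fat_ideal P m).
Proof.
split=> [j _|a u v Iu Iv j _].
  by case: (ideal_pow_ideal (point_ideal (P j)) (m j)).
by apply: (ideal_pow_ideal _ _).2; [apply: Iu | apply: Iv].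
Qed.

Lemma fat_ideal_pihomog m d F :
  fat_ideal P m F -> fat_ideal P m (pihomog mdeg d F).
Proof. by move=> IF j _; apply: ideal_pow_point_pihomog; apply: IF. Qed.

Variables (m : 'I_s -> nat) (i : 'I_s).

(** Isolates the single condition, at [P_i], that separates [I_Z] from [I_{Z'}]. *)
Lemma fat_ideal_lowerE F : fat_ideal P m F <->
  fat_ideal P (lower_mult m i) F /\ ideal_pow (point_ideal (P i)) (m i) F.
Proof.
split=> [IF|[IF Fi] j _].
  split=> [j _|]; last exact: IF.
  apply: ideal_pow_le (IF j I); rewrite /lower_mult.
  by case: ifP => // _; apply: leq_pred.
by have := IF j I; rewrite /lower_mult; case: eqP => [->|].
Qed.

End FatIdeal.

(** * Generators of [I_{Z'}] modulo [I_Z] through leading forms *)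

Section Separators.
Variables (k : fieldType) (n s : nat) (P : 'I_s -> proj_point k n.+1).
Hypothesis P_inj : injective P.
Variables (m : 'I_s -> nat) (i : 'I_s) (d : nat).
Hypothesis mi : m i = d.+1.
Variable A : 'M[k]_n.+2.
Hypotheses (unitA : A \in unitmx) (Pi_A : val (P i) = <[row ord0 A]>%VS).
Implicit Types (F G : {mpoly k[n.+2]}) (e : nat).

Local Notation IZ := (fat_ideal P m).
Local Notation IZ' := (fat_ideal P (lower_mult m i)).
Local Notation lead := (leading_form d A).
Local Notation span_seq t := (ideal_span [set` t]).

Lemma fat_lower_order F :
  IZ' F -> order_ge (@tail_deg n.+1) d (lin_subst A F).
Proof.
move=> /(_ i I); rewrite /lower_mult eqxx mi.
by rewrite (ideal_pow_pointP unitA Pi_A).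
Qed.

Lemma fat_leading_form F : IZ F -> lead F = 0.
Proof.
move=> /(fat_ideal_lowerE _ _ i)[_]; rewrite mi (ideal_pow_pointP unitA Pi_A).
exact: leading_form_eq0.
Qed.

Lemma fat_lower_ker F : is_form F -> IZ' F -> lead F = 0 -> IZ F.
Proof.
move=> hF IF lF; apply/(fat_ideal_lowerE _ _ i); split=> //.
rewrite mi (ideal_pow_pointP unitA Pi_A); apply: leading_form_ker => //.
exact: fat_lower_order.
Qed.

Lemma leading_form_separator F :
  is_form F -> IZ' F -> lead F != 0 -> is_separator P m i F.
Proof.
move=> hF IF lF; split=> //.
- by have := IF i I; rewrite /lower_mult eqxx.
- rewrite mi (ideal_pow_pointP unitA Pi_A) => /leading_form_eq0 lF0.
  by rewrite lF0 eqxx in lF.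
- by move=> j /negPf ji; have := IF j I; rewrite /lower_mult ji.
Qed.

(** One degree [D] serves all [w], which later bounds the degrees in which generators must be
    sought. *)
Lemma leading_form_onto :
  exists D, forall w, exists F, [/\ IZ' F, F \is D.-homog & lead F = w].
Proof.
have [H [[h hH] Hv Hj]] := fat_separating_form m P_inj Pi_A.
set c := H.@[_] in Hv; exists (h + d)%N => w.
(* Multiplication by [H] scales the leading form by [c = H(v)], which the factor [c^-1]
   compensates. *)
pose G := lin_subst (invmx A) (tail_incl (mpoly_of_dhomog (c^-1 *: w))).
have GA : lin_subst A G = tail_incl (mpoly_of_dhomog (c^-1 *: w)).
  by rewrite lin_substVK.
have oG : order_ge (@tail_deg n.+1) d (lin_subst A G).
  by rewrite GA; apply/tail_incl_order_ge/dhomog_is_dhomog.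
exists (H * G); split.
- move=> j _; rewrite /lower_mult; case: (eqVneq j i) => [->|ji].
    apply: (is_idealMl _ (ideal_pow_ideal _ _)).
    by rewrite (ideal_pow_pointP unitA Pi_A) mi.
  rewrite mulrC; apply: (is_idealMl _ (ideal_pow_ideal _ _)); exact: Hj.
- apply: dhomogM => //; apply: lin_subst_dhomog.
  by apply: tail_incl_dhomog; apply: dhomog_is_dhomog.
- rewrite leading_formM //; apply: val_inj => /=; rewrite GA dehom_tail_incl.
  rewrite pihomog_dE; last exact: dhomog_is_dhomog.
  by rewrite /= scalerA mulfV // scale1r.
Qed.

(** The multiplier is a power of the adapted coordinate [x_0], whose value at the spanning vector of
    [P_i] is 1. *)
Lemma leading_form_raise F e e' : (e <= e')%N -> F \is e.-homog ->
  exists c, c * F \is e'.-homog /\ (IZ' F -> lead (c * F) = lead F).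
Proof.
move=> ee' hF; exists (coord_form A ord0 ^+ (e' - e)); split.
  have := dhomogMn (e' - e)%N (coord_form_dhomog A ord0).
  by rewrite mul1n => /dhomogM/(_ hF); rewrite subnK.
move=> /fat_lower_order oF; rewrite leading_formM // rmorphXn /=.
rewrite rowE -meval_lin_subst lin_subst_coord_form // mevalXU mxE !eqxx.
by rewrite expr1n scale1r.
Qed.

(** A combination [G] of [t], homogeneous of degree [e], is built with the leading form of [F]; then
    [F - G] is a form in the kernel of [lead], hence lies in [I_Z]. *)
Lemma fat_lower_combine (t : seq {mpoly k[n.+2]}) e F :
  (forall G, G \in t -> IZ' G /\ exists2 e', (e' <= e)%N & G \is e'.-homog) ->
  IZ' F -> F \is e.-homog -> lead F \in <<map lead t>>%VS ->
  exists2 G, span_seq t G & IZ (F - G).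
Proof.
move=> tP IF hF lF; have idI := fat_ideal_ideal P (lower_mult m i).
have idt : is_ideal (span_seq t) by apply: ideal_span_ideal.
(* Asking for degree exactly [e] makes these leading forms closed under linear combination; elements
   of [t] of lower degree are first raised to degree [e]. *)
pose Q w := exists G, [/\ span_seq t G, IZ' G, G \is e.-homog & lead G = w].
have [] : Q (lead F).
  apply: (span_closure _ _ _ lF).
  - by exists 0; split; rewrite ?rpred0 ?raddf0 //; [case: idt | case: idI].
  - move=> c _ _ [G1 [tG1 IG1 hG1 <-]] [G2 [tG2 IG2 hG2 <-]].
    exists (c%:MP * G1 + G2); split; [exact: idt.2|exact: idI.2| |].
      by rewrite mul_mpolyC rpredD ?rpredZ.
    by rewrite mul_mpolyC linearP.
  - move=> _ /mapP[G Gt ->]; have [IG [e' ee' hG]] := tP G Gt.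
    have [c [hcG lcG]] := leading_form_raise ee' hG.
    exists (c * G); split; [|exact: (is_idealMl _ idI)|exact: hcG|exact: lcG].
    by apply: (is_idealMl _ idt); apply: sub_ideal_span.
move=> G [tG IG hG lG]; exists G; first exact: tG.
apply: fat_lower_ker.
- by exists e; apply: rpredB.
- exact: (is_idealB idI).
- by rewrite linearB /= lG subrr.
Qed.

(* Going from [e] to [e.+1], the leading forms of the degree [e] elements of
   [IZ'] are added to the free family [map lead t]; they do not disturb the
   generation of lower degrees, and [fat_lower_combine] handles degree [e]. *)
Lemma fat_lower_filtration e : exists t : seq {mpoly k[n.+2]},
  [/\ free (map lead t),
      forall G, G \in t -> IZ' G /\ exists2 e', (e' <= e)%N & G \is e'.-homog
    & forall F e', (e' < e)%N -> IZ' F -> F \is e'.-homog ->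
        exists2 G, span_seq t G & IZ (F - G)].
Proof.
elim: e => [|e [t [free_t tP t_gen]]]; first by exists [::]; rewrite nil_free.
pose S : set {mpoly k[n.+2]} := [set F | IZ' F /\ F \is e.-homog].
have [u [free_ut uS] ut_span] := free_extension S free_t.
have utP G : G \in u ++ t ->
    IZ' G /\ exists2 e', (e' <= e)%N & G \is e'.-homog.
  by rewrite mem_cat => /orP[/uS[IG hG]|/tP //]; split=> //; exists e.
exists (u ++ t); split=> //.
  by move=> G /utP[IG [e' ee' hG]]; split=> //; exists e' => //; apply: leqW.
move=> F e'; rewrite ltnS leq_eqVlt => /orP[/eqP -> IF hF|e'e IF hF].
  exact: (fat_lower_combine utP IF hF (ut_span _ (conj IF hF))).
have [G tG IFG] := t_gen F e' e'e IF hF; exists G => //.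
by apply: ideal_span_le tG => x /= xt; rewrite mem_cat xt orbT.
Qed.

(** Since [lead (a F)] is a scalar multiple of [lead F], polynomial combinations of a family have
    leading forms in its linear span. *)
Lemma leading_form_span (U : {vspace dhomog n.+1 k d}) :
  is_ideal [set F | IZ' F /\ lead F \in U].
Proof.
have idI := fat_ideal_ideal P (lower_mult m i).
split=> [|a F G [IF FU] [IG GU]] /=.
  by split; [case: idI | rewrite raddf0 mem0v].
split; first exact: idI.2.
rewrite raddfD /= leading_formM; last exact: fat_lower_order.
exact: memvD (memvZ _ FU) GU.
Qed.

Lemma dim_leading_form : \dim {:dhomog n.+1 k d} = 'C(d + n, d).
Proof. by rewrite dimvf. Qed.

Lemma fat_lower_basis : exists t : seq {mpoly k[n.+2]},
  [/\ size t = 'C(d + n, d),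
      forall F, F \in t -> IZ' F /\ is_separator P m i F
    & forall F, IZ' F -> exists2 G, span_seq t G & IZ (F - G)].
Proof.
have [D onto] := leading_form_onto.
(* The filtration generates strictly below its index, so [D.+1] is what covers degree [D]. *)
have [t [free_t tP t_gen]] := fat_lower_filtration D.+1.
(* Every [w] is the leading form of some [F] of degree [D]; modulo [I_Z], which [lead] kills, [F] is
   a combination of [t]. *)
have full_t : <<map lead t>>%VS = fullv.
  apply/eqP; rewrite eqEsubv subvf; apply/subvP => w _.
  have [F [IF hF <-]] := onto w.
  have [G tG IFG] := t_gen F D (ltnSn D) IF hF.
  suff [_] : [set F | IZ' F /\ lead F \in <<map lead t>>%VS] G.
    by rewrite -[F](subrK G) linearD /= (fat_leading_form IFG) add0r.
  apply: (ideal_span_min (leading_form_span _)) tG => x /= xt.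
  by split; [case: (tP x xt) | apply: memv_span; apply: map_f].
exists t; split.
- by rewrite -dim_leading_form -full_t (eqP free_t) size_map.
- move=> F Ft; have [IF [e _ hF]] := tP F Ft; split=> //.
  apply: leading_form_separator => //; first by exists e.
  exact: free_not0 free_t (map_f _ Ft).
(* Beyond degree [D] no new generator is required, as the leading forms of [t] already span
   everything. *)
have gen_form F e : IZ' F -> F \is e.-homog ->
    exists2 G, span_seq t G & IZ (F - G).
  move=> IF hF; case: (ltnP e D.+1) => [eD|De]; first exact: t_gen hF.
  apply: (fat_lower_combine (e := e)) => //; last by rewrite full_t memvf.
  move=> G /tP[IG [e' eD hG]]; split=> //; exists e' => //.
  exact: leq_trans De.
(* An arbitrary [F] is treated through its homogeneous components, which stay in [I_{Z'}]. *)
move=> F IF; have /choice[g gP] (e : nat) :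
    exists G, span_seq t G /\ IZ (pihomog mdeg e F - G).
  have [G] := gen_form _ e (fat_ideal_pihomog e IF) (pihomogP _ _ _).
  by exists G.
exists (\sum_(e < msize F) g e).
  by apply: (is_ideal_sum _ (ideal_span_ideal _)) => e _; case: (gP e).
rewrite [F in F - _](pihomog_partitionE (leqnn (msize F))) -sumrB.
by apply: (is_ideal_sum _ (fat_ideal_ideal P m)) => e _; case: (gP e).
Qed.

(** The leading forms of any generating family, homogeneous or not, span the whole space of leading
    forms, so the dimension bounds its size from below. *)
Lemma fat_lower_min_size (t : seq {mpoly k[n.+2]}) :
  (forall F, F \in t -> IZ' F) ->
  (forall F, IZ' F -> exists2 G, span_seq t G & IZ (F - G)) ->
  ('C(d + n, d) <= size t)%N.
Proof.
move=> tI t_gen; have [D onto] := leading_form_onto.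
rewrite -dim_leading_form -(size_map lead).
suff -> : fullv = <<map lead t>>%VS by apply: dim_span.
apply/eqP; rewrite eq_sym eqEsubv subvf; apply/subvP => w _.
have [F [IF hF <-]] := onto w; have [G tG IFG] := t_gen F IF.
suff [_] : [set F | IZ' F /\ lead F \in <<map lead t>>%VS] G.
  by rewrite -[F](subrK G) linearD /= (fat_leading_form IFG) add0r.
apply: (ideal_span_min (leading_form_span _)) tG => x /= xt.
by split; [apply: tI | apply: memv_span; apply: map_f].
Qed.

End Separators.

(** * Passage to the quotient ring [R/I_Z] *)

Section FatClass.
Variables (k : fieldType) (n s : nat) (P : 'I_s -> proj_point k n).
Variables (m : 'I_s -> nat) (s_gt0 : (0 < s)%N) (m_gt0 : forall j, (0 < m j)%N).

Local Notation cls := (fat_class P s_gt0 m_gt0).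

Lemma fat_class_eq F G : cls F = cls G <-> fat_ideal P m (F - G).
Proof.
split=> [/eqP|FG]; first by rewrite -Quotient.idealrBE => /set_mem.
by apply/eqP; rewrite -Quotient.idealrBE; apply/mem_set.
Qed.

(** The projection is surjective, so coefficients in the quotient lift through [repr]. *)
Lemma fat_class_ideal_span (S : set {mpoly k[n.+1]}) :
  ideal_span (cls @` S) = cls @` ideal_span S.
Proof.
have clsD F G : cls (F + G) = cls F + cls G by apply: rmorphD.
have clsM F G : cls (F * G) = cls F * cls G by apply: rmorphM.
have cls0 : cls 0 = 0 by apply: rmorph0.
have idS := ideal_span_ideal S; have idcS := ideal_span_ideal (cls @` S).
apply/seteqP; split.
  apply: ideal_span_min => [|_ [F SF <-]]; last first.
    by exists F => //; apply: sub_ideal_span.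
  split=> [|a _ _ [F SF <-] [G SG <-]]; first by exists 0 => //; case: idS.
  exists (repr a * F + G); first exact: idS.2.
  by rewrite clsD clsM; congr (_ * _ + _); apply: reprK.
move=> _ [F SF <-]; move: F SF.
apply: (@ideal_span_min _ S [set F | ideal_span (cls @` S) (cls F)]).
  split=> [|a F G SF SG] /=; first by rewrite cls0; case: idcS.
  by rewrite clsD clsM; apply: idcS.2.
by move=> F SF; apply: sub_ideal_span; exists F.
Qed.

End FatClass.

(** All terms but the [i]-th cancel, and Pascal's rule gives
    [C(d+n+1, n+1) - C(d+n, n+1) = C(d+n, n)]. *)
Lemma fat_degree_lower n s (m : 'I_s -> nat) i d : m i = d.+1 ->
  (fat_degree n.+1 m - fat_degree n.+1 (lower_mult m i))%N = 'C(d + n, d).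
Proof.
move=> mi; rewrite /fat_degree !(bigD1 (P := xpredT) i) //=.
rewrite [X in (_ - (_ + X))%N](eq_bigr (fun j => 'C(m j + n.+1 - 1, n.+1))).
  rewrite subnDr /lower_mult eqxx mi /= !addnS !subn1 /= addSn binS addnC addnK.
  by rewrite -[in RHS]bin_sub ?leq_addr // addKn.
by move=> j /negPf ji; rewrite /lower_mult ji.
Qed.

Theorem theorem3p3 (k : closedFieldType) (char0 : [pchar k] =i pred0)
  (n : nat) (n_gt0 : (0 < n)%N) (s : nat) (s_gt0 : (0 < s)%N)
  (P : 'I_s -> proj_point k n) (P_inj : injective P)
  (m : 'I_s -> nat) (m_gt0 : forall j, (0 < m j)%N) (i : 'I_s) :
  let nu := (fat_degree n m - fat_degree n (lower_mult m i))%N in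
  let cls := fat_class P s_gt0 m_gt0 in
  let IZ'_IZ : set (fat_ring P s_gt0 m_gt0) :=
    cls @` fat_ideal P (lower_mult m i) in
  exists F : 'I_nu -> {mpoly k[n.+1]},
    [/\ forall j, is_separator P m i (F j),
        IZ'_IZ = ideal_span (range (fun j => cls (F j)))
      & forall G : seq (fat_ring P s_gt0 m_gt0),
          (size G < nu)%N -> ideal_span [set` G] <> IZ'_IZ].
Proof.
case: n n_gt0 P P_inj => // n _ P P_inj nu cls IZ'_IZ.
have [d mi] : exists d, m i = d.+1 by exists (m i).-1; rewrite prednK.
have nuE : nu = 'C(d + n, d) by apply: fat_degree_lower.
have [A unitA PA] := point_frame (P i).
have [t [t_size t_sep t_gen]] := fat_lower_basis P_inj mi unitA PA.
have t_nu : size t = nu by rewrite t_size.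
exists (fun j => t`_j); split.
- by move=> j; apply: (t_sep _ _).2; rewrite mem_nth // t_nu.
- have -> : range (fun j : 'I_nu => cls t`_j) = cls @` [set` t].
    apply/seteqP; split=> [_ [j _ <-]|_ [F /= Ft <-]].
      by exists t`_j => //=; rewrite mem_nth // t_nu.
    have Fj : (index F t < nu)%N by rewrite -t_nu index_mem.
    by exists (Ordinal Fj) => //=; rewrite nth_index.
  rewrite fat_class_ideal_span; apply/seteqP; split=> _ [F IF <-].
    by have [G tG IFG] := t_gen F IF; exists G => //; apply/esym/fat_class_eq.
  exists F => //; apply: ideal_span_min IF; first exact: fat_ideal_ideal.
  by move=> G /t_sep[].
- move=> G G_size G_gen.
  (* For minimality, each element of [G] lies in [I_{Z'}/I_Z] and is lifted to [I_{Z'}]; outside [G]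
     the default is 0. *)
  have /choice[f fP] x : exists F, x \in G ->
      fat_ideal P (lower_mult m i) F /\ cls F = x.
    case: (boolP (x \in G)) => [xG|_]; last by exists 0.
    have : IZ'_IZ x by rewrite -G_gen; apply: sub_ideal_span.
    by case=> F IF Fx; exists F.
  have GE : [set` G] = cls @` [set` map f G].
    apply/seteqP; split=> [x /= xG|_ [_ /mapP[x xG ->] <-]].
      by exists (f x); [apply: map_f | case: (fP x xG)].
    by rewrite /= (fP x xG).2.
  (* The lifts generate [I_{Z'}] modulo [I_Z], so the dimension bound contradicts the size of
     [G]. *)
  suff : (nu <= size (map f G))%N by rewrite size_map leqNgt G_size.
  rewrite nuE; apply: (fat_lower_min_size P_inj mi unitA PA).
    by move=> _ /mapP[x xG ->]; case: (fP x xG).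
  move=> F IF; have : IZ'_IZ (cls F) by exists F.
  rewrite -G_gen GE fat_class_ideal_span => -[H fH /esym FH].
  by exists H => //; apply/fat_class_eq.
Qed.
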